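(* Let $b\ge2$ and $N$ be positive integers with $\gcd(N,b)=1$ and $|\mathcal{M}_b(N)|>1$. Then there exists a positive integer $z$ with $\gcd(z,b)=1$ such that $\mathcal{M}_b(zN)=\{|b|_N\}$.
   Context: $|b|_N$ denotes the multiplicative order of $b$ modulo $N$ (defined only when $\gcd(N,b)=1$), and $\mathbb{U}_N=\{x: 1\le x<N,\ \gcd(x,N)=1\}$. Midy's set: for an integer $d\ge 2$ dividing $|b|_N$, put $L=|b|_N$ and $k=L/d$. For $x\in\mathbb{U}_N$, let $a_1\cdots a_L$ be the base-$b$ digits (padded with leading zeros to exactly $L$ digits) of the integer $x(b^L-1)/N$ (the period of the base-$b$ expansion of $x/N$). For $j=1,\dots,d$ let $A_j=[a_{(j-1)k+1}\cdots a_{jk}]_b$ be the integer with the $j$-th block of $k$ digits, and $S_d(x)=\sum_{j=1}^d A_j$. $N$ has the Midy property for $b$ and $d$ if $b^k-1\mid S_d(x)$ for all $x\in\mathbb{U}_N$; the Midy set $\mathcal{M}_b(N)$ is the set of integers $d\ge2$ dividing $|b|_N$ for which this holds. *)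

(* Defs.v *)
From mathcomp Require Import all_boot cyclic finmap.

Set Implicit Arguments.
Unset Strict Implicit.
Unset Printing Implicit Defensive.

Local Open Scope nat_scope.

(* |b|_N, the least n >= 1 with b ^ n = 1 mod N.  When N and b are coprime it *)
(* is at most N (Euler), so the search range is large enough; see mulordP.   *)
(* The value is the junk 0 when N and b are not coprime.                     *)
Definition mulord (b N : nat) : nat :=
  head 0 [seq n <- iota 1 N | b ^ n == 1 %[mod N]].

Lemma mulordP (b N : nat) : 0 < N -> coprime N b ->
  [/\ 0 < mulord b N, b ^ mulord b N = 1 %[mod N]
    & forall n, 0 < n -> b ^ n = 1 %[mod N] -> mulord b N <= n].
Proof.
move=> N_gt0 coNb; rewrite /mulord.
set p := fun n => b ^ n == 1 %[mod N].
have tot_in : totient N \in [seq n <- iota 1 N | p n].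
  rewrite mem_filter mem_iota totient_gt0 N_gt0 add1n ltnS /p.
  rewrite Euler_exp_totient 1?coprime_sym // eqxx /= totient_count_coprime.
  rewrite -[leqRHS]muln1 -[X in _ <= X * _]subn0 -sum_nat_const_nat.
  by apply: leq_sum => i _; apply: leq_b1.
have srt : sorted ltn [seq n <- iota 1 N | p n].
  by apply: sorted_filter; [apply: ltn_trans | apply: iota_ltn_sorted].
case E: [seq n <- iota 1 N | p n] tot_in srt => [|m s] // _ /= srt.
have : m \in [seq n <- iota 1 N | p n] by rewrite E mem_head.
rewrite mem_filter mem_iota => /and3P[/eqP pm m_gt0 mN]; split=> // n n_gt0 pn.
have [nN|/ltnW Nn] := leqP n N; last by apply: leq_trans Nn; rewrite -ltnS -add1n.
have : n \in m :: s by rewrite -E mem_filter mem_iota n_gt0 add1n ltnS nN /p pn eqxx.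
rewrite inE => /predU1P[-> //|ns].
by apply: ltnW; move: srt; rewrite (path_sortedE ltn_trans) => /andP[/allP/(_ n ns)].
Qed.

(* The integer x (b ^ L - 1) / N with L = |b|_N; the division is exact when N *)
(* and b are coprime.                                                         *)
Definition period (b N x : nat) : nat := x * (b ^ mulord b N - 1) %/ N.

(* The digit a_i of the period, numbered from 1 (most significant) to L, the *)
(* expansion being padded on the left to L digits.                           *)
Definition period_digit (b N x i : nat) : nat :=
  (period b N x %/ b ^ (mulord b N - i)) %% b.

(* A_j = [a_((j - 1) k + 1) .. a_(j k)]_b with k = L / d, for 1 <= j <= d. *)
Definition period_block (b N d x j : nat) : nat :=
  let k := mulord b N %/ d in
  \sum_(1 <= i < k.+1) period_digit b N x (j.-1 * k + i) * b ^ (k - i).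

Definition block_sum (b N d x : nat) : nat :=
  \sum_(1 <= j < d.+1) period_block b N d x j.

Definition Midy_property (b N d : nat) : bool :=
  [forall x : 'I_N, (0 < x) && coprime x N ==>
     (b ^ (mulord b N %/ d) - 1 %| block_sum b N d x)].

Definition Midy_set (b N : nat) : {fset nat} :=
  [fset d in divisors (mulord b N) | (1 < d) && Midy_property b N d]%fset.

(* Main.v *)
Require Import Defs.
From mathcomp Require Import all_boot finmap.

(** Write L = |b|_N and k = L / d.  Since b ^ k = 1 modulo b ^ k - 1, the sum of
    the d blocks of the period is congruent to the period itself, so that d
    is in the Midy set of N iff N * (b ^ k - 1) divides b ^ L - 1.  If this
    holds for some d, then N divides M = (b ^ L - 1) / (b - 1).  The order of b
    modulo M is again L because b ^ n - 1 < M for n < L, and M * (b ^ k - 1)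
    divides b ^ L - 1 = M * (b - 1) only for k = 1, that is, for d = L. *)

Local Open Scope nat_scope.

(** Induction on [m] splits off the leading digit. This is used twice: with [B = b] for the digits
    inside a block, and with [B = b ^ k] for the blocks inside the period. *)
Lemma modn_exp_digits (B n m : nat) :
  n %% B ^ m = \sum_(1 <= i < m.+1) n %/ B ^ (m - i) %% B * B ^ (m - i).
Proof.
elim: m => [|m IHm]; first by rewrite big_geq // modn1.
rewrite big_nat_recl // subSS subn0.
under eq_bigr => i _ do rewrite subSS.
rewrite -IHm.
(* For [B = 0] both sides equal [n], by the convention [n %% 0 = n]. *)
have [->|B_gt0] := posnP B.
  case: m {IHm} => [|m]; last by rewrite !exp0n // muln0 add0n.
  by rewrite expn0 expn1 divn1 muln1 modn1 addn0.
have Bm_gt0 : 0 < B ^ m by rewrite expn_gt0 B_gt0.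
rewrite {1}(divn_eq n (B ^ m)) {1}(divn_eq (n %/ B ^ m) B) mulnDl -mulnA -expnS.
rewrite -addnA modnMDl modn_small //.
have : n %/ B ^ m %% B < B by rewrite ltn_mod.
rewrite -(leq_pmul2r Bm_gt0) -expnS mulSn => /(leq_trans _); apply.
by rewrite addnC ltn_add2r ltn_mod.
Qed.

(** The blocks are the digits of the period in base [b ^ k]. *)
Lemma period_blockE (b N d x j : nat) :
  d %| mulord b N -> 0 < j <= d ->
  period_block b N d x j =
    period b N x %/ (b ^ (mulord b N %/ d)) ^ (d - j) %% b ^ (mulord b N %/ d).
Proof.
move=> dL /andP[j_gt0 jd]; rewrite /period_block /period_digit modn_exp_digits.
set k := mulord b N %/ d.
have Lk : mulord b N = d * k by rewrite mulnC divnK.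
apply: eq_big_nat => i /andP[i_gt0]; rewrite ltnS => ik.
rewrite -divnMA -expnM -expnD; congr (_ %/ b ^ _ %% b * _).
(* Digit [i] of block [j] has weight exponent [(d - j) * k + (k - i)]. *)
have -> : mulord b N = (d - j) * k + k + j.-1 * k.
  by rewrite Lk -addnA -mulSn prednK // -mulnDl subnK.
by rewrite subnDA addnK mulnC addnBA.
Qed.

(** Ensures that the [d] blocks capture the whole period, not just a residue of it. *)
Lemma period_ltn (b N x : nat) :
  0 < b -> x < N -> period b N x < b ^ mulord b N.
Proof.
move=> b_gt0 xN; have N_gt0 : 0 < N by apply: leq_ltn_trans xN.
have bL_gt0 : 0 < b ^ mulord b N by rewrite expn_gt0 b_gt0.
rewrite /period ltn_divLR //; apply: (@leq_ltn_trans (x * b ^ mulord b N)).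
  by rewrite leq_mul2l leq_subr orbT.
by rewrite mulnC ltn_pmul2l.
Qed.

Lemma block_sum_mod (b N d x : nat) :
  0 < b -> x < N -> d %| mulord b N ->
  block_sum b N d x = period b N x %[mod b ^ (mulord b N %/ d) - 1].
Proof.
move=> b_gt0 xN dL; set k := mulord b N %/ d.
have Lk : mulord b N = k * d by rewrite divnK.
have bk1 : b ^ k = 1 %[mod b ^ k - 1].
  have bk_gt0 : 0 < b ^ k by rewrite expn_gt0 b_gt0.
  by rewrite -{1}(subnKC bk_gt0) modnDr.
have P_lt := period_ltn _ _ _ b_gt0 xN.
rewrite -[in RHS](modn_small P_lt) Lk expnM modn_exp_digits /block_sum.
rewrite !big_nat.
elim/big_rec2: _ => // j y1 y2 jd IH.
(* Term by term, the weight [(b ^ k) ^ (d - j)] is replaced by 1. *)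
rewrite period_blockE // -/k -modnDm IH modnDm -[in RHS]modnDml -modnMmr.
by rewrite -modnXm bk1 modnXm exp1n modnMmr muln1 modnDml.
Qed.

(** The period of [x / N] is [x] times that of [1 / N], so the condition for all [x] reduces to the
    one for [x = 1]. *)
Lemma Midy_propertyE (b N d : nat) :
  0 < b -> 1 < N -> coprime N b -> d %| mulord b N ->
  Midy_property b N d =
    (N * (b ^ (mulord b N %/ d) - 1) %| b ^ mulord b N - 1).
Proof.
move=> b_gt0 N_gt1 coNb dL; have N_gt0 := ltnW N_gt1.
have [_ /eqP bL1 _] := mulordP N_gt0 coNb.
have NbL : N %| b ^ mulord b N - 1.
  by rewrite -eqn_mod_dvd // expn_gt0 b_gt0.
have sumE x : x < N -> (b ^ (mulord b N %/ d) - 1 %| block_sum b N d x) =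
    (b ^ (mulord b N %/ d) - 1 %| x * ((b ^ mulord b N - 1) %/ N)).
  move=> xN; rewrite muln_divA // -/(period b N x).
  by rewrite /dvdn (block_sum_mod _ _ _ _ b_gt0 xN dL).
rewrite mulnC -dvdn_divRL //.
apply/forallP/idP => [/(_ (Ordinal N_gt1))|dv x].
  by rewrite /= coprime1n sumE // mul1n.
by apply/implyP => _; rewrite sumE // dvdn_mull.
Qed.

Lemma in_Midy_set (b N d : nat) :
  0 < b -> 1 < N -> coprime N b ->
  (d \in Midy_set b N) =
    [&& d %| mulord b N, 1 < d &
        N * (b ^ (mulord b N %/ d) - 1) %| b ^ mulord b N - 1].
Proof.
move=> b_gt0 N_gt1 coNb; have [L_gt0 _ _] := mulordP (ltnW N_gt1) coNb.
rewrite !inE /= -dvdn_divisors //; case: (boolP (d %| _)) => //= dL.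
by rewrite Midy_propertyE.
Qed.

(** Modulo 1 the order is 1, which has no divisor above 1. *)
Lemma Midy_set1 (b : nat) : Midy_set b 1 = fset0.
Proof.
apply/fsetP => d; rewrite !inE /= /mulord /= modn1 /=.
by apply/negP => /and3P[]; rewrite unfold_in orbF => /eqP->.
Qed.

(** The sum is [(b ^ L - 1) / (b - 1)] written without division; it is 1 plus a multiple of [b]. *)
Lemma coprime_repunit (b L : nat) : 0 < L -> coprime (\sum_(i < L) b ^ i) b.
Proof.
case: L => // L _; rewrite big_ord_recl /=.
under eq_bigr => i _ do rewrite expnS.
by rewrite -big_distrr /= addnC mulnC /coprime gcdnC gcdnMDl gcdn1.
Qed.

Lemma mulord_repunit (b L : nat) : 1 < b -> 0 < L ->
  mulord b (\sum_(i < L) b ^ i) = L.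
Proof.
move=> b_gt1 L_gt0; set M := \sum_(i < L) b ^ i.
have b_gt0 := ltnW b_gt1.
have bX_gt0 n : 0 < b ^ n by rewrite expn_gt0 b_gt0.
have M_ge : b ^ L.-1 <= M.
  by rewrite /M; case: (L) L_gt0 => // l _; rewrite big_ord_recr leq_addl.
have M_gt0 : 0 < M by apply: leq_trans M_ge.
have [n_gt0 /eqP bn1 n_min] := mulordP M_gt0 (coprime_repunit b L L_gt0).
apply/eqP; rewrite eqn_leq n_min //=; last first.
  by apply/eqP; rewrite eqn_mod_dvd // subn1 predn_exp dvdn_mull.
(* An order [n < L] would give [M <= b ^ n - 1 < b ^ L.-1 <= M]. *)
rewrite leqNgt; apply/negP => nL; move: bn1; rewrite eqn_mod_dvd // => /dvdn_leq.
rewrite subn_gt0 -{1}(expn0 b) ltn_exp2l // => /(_ n_gt0) le_M.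
have : b ^ mulord b M <= b ^ L.-1 by rewrite leq_exp2l // -ltnS prednK.
by move=> /leq_trans/(_ M_ge)/leq_trans/(_ le_M); rewrite leqNgt subn1 ltn_predL bX_gt0.
Qed.

Lemma Midy_set_repunit (b L : nat) : 1 < b -> 1 < L ->
  Midy_set b (\sum_(i < L) b ^ i) = [fset L]%fset.
Proof.
move=> b_gt1 L_gt1; have L_gt0 := ltnW L_gt1; have b_gt0 := ltnW b_gt1.
have ordM := mulord_repunit b L b_gt1 L_gt0.
have coMb := coprime_repunit b L L_gt0.
have M_gt1 : 1 < \sum_(i < L) b ^ i.
  case: L L_gt1 {L_gt0 ordM coMb} => [|[|L]] // _.
  by rewrite !big_ord_recl /= expn0 addnA ltn_addr // addn_gt0 expn_gt0 b_gt0.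
apply/fsetP => d; rewrite in_Midy_set // ordM in_fset1 !subn1.
(* Cancelling the repunit leaves [b ^ (L %/ d) - 1] dividing [b - 1], which is positive. *)
rewrite (predn_exp b L) (mulnC b.-1) dvdn_pmul2l ?(ltnW M_gt1) //.
apply/and3P/eqP => [[dL d_gt1]|->]; last first.
  by rewrite dvdnn divnn L_gt0 expn1.
move/dvdn_leq; rewrite -!subn1 subn_gt0 => /(_ b_gt1).
rewrite leq_subLR subnKC // -{2}(expn1 b) leq_exp2l // => k_le1.
have k_gt0 : 0 < L %/ d by rewrite divn_gt0 ?(ltnW d_gt1) // dvdn_leq.
have k1 : L %/ d = 1 by apply/eqP; rewrite eqn_leq k_le1.
by rewrite -(divnK dL) k1 mul1n.
Qed.

Theorem theorem2p12 (b N : nat) (b_ge2 : 2 <= b) (N_gt0 : 0 < N)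
    (coNb : coprime N b) (M_gt1 : 1 < #|` Midy_set b N|%fset) :
  exists z : nat,
    [/\ 0 < z, coprime z b & Midy_set b (z * N) = [fset mulord b N]%fset].
Proof.
have b_gt0 := ltnW b_ge2.
have N_gt1 : 1 < N.
  case: N N_gt0 coNb M_gt1 => [|[|N]] // _ _.
  by rewrite Midy_set1 cardfs0.
have /fset0Pn[d] : Midy_set b N != fset0 by rewrite -cardfs_gt0 ltnW.
rewrite in_Midy_set // => /and3P[dL d_gt1].
have [L_gt0 _ _] := mulordP N_gt0 coNb.
set L := mulord b N in dL L_gt0 * => Ndv.
have L_gt1 : 1 < L by apply: leq_trans d_gt1 (dvdn_leq _ dL).
(* As [b - 1] divides [b ^ k - 1], the product [(b - 1) * N] divides [b ^ L - 1]; then [b - 1]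
   cancels. *)
have NM : N %| \sum_(i < L) b ^ i.
  rewrite -(@dvdn_pmul2l b.-1) -?predn_exp; last by rewrite -subn1 subn_gt0.
  rewrite !subn1 in Ndv; apply: dvdn_trans Ndv.
  by rewrite mulnC dvdn_pmul2l // predn_exp dvdn_mulr.
have coMb := coprime_repunit b L L_gt0.
(* With this [z], the product [z * N] is the repunit, and [z] inherits coprimality with [b] as its
   divisor. *)
exists ((\sum_(i < L) b ^ i) %/ N); split.
- rewrite divn_gt0 // dvdn_leq //.
  by case: (L) L_gt0 => // l _; rewrite big_ord_recl.
- by apply: coprime_dvdl coMb; apply: dvdn_div.
- by rewrite divnK // Midy_set_repunit.
Qed.
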